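(* Let $G=(V\cup\{m\},E)$ and $G'=(V'\cup\{m'\},E')$ be comparability graphs with disjoint vertex sets, with $\mathcal{R}^p(G)=k$ and $\mathcal{R}^p(G')=k'$. Then: (1) $G\ast G'$ is a comparability graph if and only if at least one of the following holds: (a) there exist transitive orientations of $G$ and $G'$ such that $m$ is a source and $m'$ is a sink, or $m$ is a sink and $m'$ is a source; (b) $m$ is adjacent to all vertices of $V$ in $G$, or $m'$ is adjacent to all vertices of $V'$ in $G'$. (2) If $G\ast G'$ is a comparability graph, then $\mathcal{R}^p(G\ast G')=\max\{k,k'\}$ or $1+\max\{k,k'\}$.
   Context: All graphs are finite, simple and connected. A comparability graph is a graph admitting a transitive orientation ($\overrightarrow{ab},\overrightarrow{bc}$ imply $\overrightarrow{ac}$); a source (sink) is a vertex of in-degree (out-degree) zero. A word over the vertex set represents a graph if distinct vertices are adjacent iff they alternate in the word (the subword formed by their occurrences is $abab\cdots$ or $baba\cdots$). Comparability graphs are exactly the graphs represented by a concatenation of permutations of their vertex set; $\mathcal{R}^p(G)$ is the least number of permutations whose concatenation represents $G$. Split recomposition: $G\ast G'$ has vertex set $V\cup V'$ and edges: those of $G[V]$, those of $G'[V']$, and all $\overline{ab}$ with $a\in N_G(m)$, $b\in N_{G'}(m')$.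
   Formalization: Part (2) is stated for V and V' both nonempty; with V empty it fails, e.g. G the single vertex m and G' the path on three vertices with m' an end: k=1, k'=2, but G∗G' is an edge, represented by one permutation. *)

(* Defs.v *)
From mathcomp Require Import all_boot.

Set Implicit Arguments.
Unset Strict Implicit.
Unset Printing Implicit Defensive.

Record sgraph := SGraph {
  vertex :> finType;
  adj : rel vertex;
  adj_sym : symmetric adj;
  adj_irr : irreflexive adj }.

Definition connected (G : sgraph) : Prop := forall x y : G, connect (@adj G) x y.

(* An arc [o x y] goes from x to y; every edge is oriented in exactly one way. *)
Definition orientation (G : sgraph) (o : rel G) : Prop :=
  (forall x y, adj x y = o x y || o y x) /\ (forall x y, ~~ (o x y && o y x)).

Definition transitive_orientation (G : sgraph) (o : rel G) : Prop :=
  orientation o /\ transitive o.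

Definition comparability (G : sgraph) : Prop :=
  exists o : rel G, transitive_orientation o.

Definition in_degree (T : finType) (o : rel T) (x : T) : nat := #|[set y | o y x]|.
Definition out_degree (T : finType) (o : rel T) (x : T) : nat := #|[set y | o x y]|.
Definition source (T : finType) (o : rel T) (x : T) : Prop := in_degree o x = 0.
Definition sink (T : finType) (o : rel T) (x : T) : Prop := out_degree o x = 0.

(* The word abab... of length n. *)
Definition alt_word (T : Type) (a b : T) (n : nat) : seq T :=
  mkseq (fun i => if odd i then b else a) n.

Definition alternate (T : eqType) (w : seq T) (a b : T) : bool :=
  let s := [seq c <- w | (c == a) || (c == b)] in
  (s == alt_word a b (size s)) || (s == alt_word b a (size s)).

(* As usual for word-representable graphs, every vertex must occur in the word;
   this excludes the empty word, in which all pairs alternate vacuously. *)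
Definition represents (G : sgraph) (w : seq G) : Prop :=
  (forall x : G, x \in w) /\
  (forall x y : G, x != y -> adj x y = alternate w x y).

Definition vertex_permutation (G : sgraph) (p : seq G) : bool :=
  perm_eq p (enum G).

Definition perm_representable (G : sgraph) (k : nat) : Prop :=
  exists ps : seq (seq G),
    [/\ size ps = k, all (@vertex_permutation G) ps & represents (flatten ps)].

(* [is_Rp G k] states R^p(G) = k. It is a relation because the least number
   exists only for comparability graphs. *)
Definition is_Rp (G : sgraph) (k : nat) : Prop :=
  perm_representable G k /\ (forall j, perm_representable G j -> k <= j).

Section SplitRecomposition.
Variables (G G' : sgraph) (m : G) (m' : G').

(* V and V' are the vertices of G and G' other than the markers m and m'; the
   sum type makes them disjoint. *)
Definition recomp_vertex : finType := ({x : G | x != m} + {x : G' | x != m'})%type.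

Definition recomp_adj (u v : recomp_vertex) : bool :=
  match u, v with
  | inl a, inl b => adj (val a) (val b)
  | inr a, inr b => adj (val a) (val b)
  | inl a, inr b => adj m (val a) && adj m' (val b)
  | inr b, inl a => adj m (val a) && adj m' (val b)
  end.

Lemma recomp_adj_sym : symmetric recomp_adj.
Proof. by move=> [a|a] [b|b] //=; rewrite adj_sym. Qed.

Lemma recomp_adj_irr : irreflexive recomp_adj.
Proof. by move=> [a|a] /=; rewrite adj_irr. Qed.

Definition split_recomp : sgraph := SGraph recomp_adj_sym recomp_adj_irr.

End SplitRecomposition.

(* Main.v *)
(** A concatenation of [k] permutations represents [G] iff adjacency means
    being ordered alike in all of them; the common order is then a transitive
    orientation. This orientation is only one of many, so the heart of the bound
    in (2) is that [k] permutations can be rearranged to make [m] a source,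
    whenever some transitive orientation does so. If [m] is neither a source
    nor a sink in the given order, take arcs [a -> m -> b]. Comparing with an
    orientation having [m] as a source, the edges [am] and [mb] lie in different
    implication classes (the closure of forcing), and the triangle [amb] shows
    that one of these classes misses [a] or [b]. The vertices spanned by that
    class form a nontrivial module containing [m], and one recurses into the
    module and into its quotient.

    With [m] a source and [m'] a sink, the permutations of [G] and [G'] are
    merged along the markers, and one extra permutation separates [V] from [V'].
    When [m] is universal, [G * G'] is [G'] with [m'] replaced by the module
    [G[V]], and no extra permutation is needed. Conversely [G] and [G'] are
    induced subgraphs of [G * G'], and when neither marker is universal, forcing
    at a neighbor of the marker having a neighbor outside [N(m)] directs all its
    cross edges alike. *)

Require Import Defs.
From mathcomp Require Import all_boot zify.
From Stdlib Require Import Classical.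

Set Implicit Arguments.
Unset Strict Implicit.
Unset Printing Implicit Defensive.

(** * Lexicographic combination of rankings *)

Definition lexn (T : finType) (f g : T -> nat) (x : T) : nat :=
  f x * (\max_y g y).+1 + g x.

(** The factor exceeds every value of [g], so [g] only breaks ties of [f]. *)
Lemma ltn_lexn (T : finType) (f g : T -> nat) x y :
  (lexn f g x < lexn f g y) = (f x < f y) || (f x == f y) && (g x < g y).
Proof.
rewrite /lexn.
have : g x <= \max_z g z by apply: leq_bigmax.
have : g y <= \max_z g z by apply: leq_bigmax.
move: (\max_z g z) => N hy hx.
case: (ltngtP (f x) (f y)) => [lt_f|gt_f|->] /=; last by rewrite ltn_add2l.
- have : (f x).+1 * N.+1 <= f y * N.+1 by rewrite leq_mul2r lt_f orbT.
  by rewrite mulSn; lia.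
- have : (f y).+1 * N.+1 <= f x * N.+1 by rewrite leq_mul2r gt_f orbT.
  by rewrite mulSn; lia.
Qed.

Lemma lexn_inj (T : finType) (f g : T -> nat) x y :
  lexn f g x = lexn f g y -> f x = f y /\ g x = g y.
Proof.
move=> eq_xy; have := ltn_lexn f g x y; have := ltn_lexn f g y x.
rewrite eq_xy ltnn; lia.
Qed.

(** * Families of rankings and their common order *)

Section Realizers.
Variable G : sgraph.
Implicit Types (S M : {set G}) (o : rel G).

Definition before k (r : 'I_k -> G -> nat) : rel G :=
  fun x y => [forall i, r i x < r i y].

(** Stands for [k] permutations of [S]; working relative to a vertex set keeps the induction on
    modules inside [G]. *)
Definition realizer S k (r : 'I_k -> G -> nat) : Prop :=
  (forall i, {in S &, injective (r i)}) /\
  {in S &, forall x y, adj x y = before r x y || before r y x}.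

Definition transitive_on S o : Prop :=
  [/\ {in S &, forall x y, adj x y = o x y || o y x},
      {in S &, forall x y, ~~ (o x y && o y x)}
    & {in S & &, transitive o}].

Lemma transitive_onT o :
  transitive_on [set: G] o <-> transitive_orientation o.
Proof.
split=> [[h1 h2 h3]|[[h1 h2] h3]].
  by split; [split=> x y|move=> y x z]; [apply: h1|apply: h2|apply: h3].
by split=> [x y _ _|x y _ _|y x z _ _ _]; [apply: h1|apply: h2|apply: h3].
Qed.

Lemma transitive_on_sub S M o :
  M \subset S -> transitive_on S o -> transitive_on M o.
Proof.
move=> /subsetP sMS [h1 h2 h3].
split=> [x y /sMS Sx /sMS Sy|x y /sMS Sx /sMS Sy|
         y x z /sMS Sy /sMS Sx /sMS Sz]; [exact: h1|exact: h2|exact: h3].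
Qed.

Lemma transitive_on_rev S o :
  transitive_on S o -> transitive_on S (fun x y => o y x).
Proof.
move=> [h1 h2 h3]; split=> [x y Sx Sy|x y Sx Sy|y x z Sy Sx Sz oxy oyz].
- by rewrite orbC h1.
- exact: h2.
- exact: (h3 y).
Qed.

Lemma realizer_sub S M k (r : 'I_k -> G -> nat) :
  M \subset S -> realizer S r -> realizer M r.
Proof.
move=> /subsetP sMS [h1 h2].
by split=> [i|] x y /sMS Sx /sMS Sy; [apply: h1|apply: h2].
Qed.

Lemma before_transitive_on S k (r : 'I_k -> G -> nat) :
  0 < k -> realizer S r -> transitive_on S (before r).
Proof.
move=> k_gt0 [_ adjE]; split=> // [x y _ _|y x z _ _ _].
  apply/negP=> /andP[/forallP/(_ (Ordinal k_gt0)) xy].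
  by move=> /forallP/(_ (Ordinal k_gt0)); lia.
move=> /forallP xy /forallP yz; apply/forallP=> i.
exact: ltn_trans (xy i) (yz i).
Qed.

Lemma realizer_rev S k (r : 'I_k -> G -> nat) : realizer S r ->
  exists r' : 'I_k -> G -> nat,
    realizer S r' /\ forall x y, before r' x y = before r y x.
Proof.
move=> [r_inj adjE]; pose r' i x := \max_y r i y - r i x.
have le_max i x : r i x <= \max_y r i y by apply: (leq_bigmax (F := r i)).
have bE x y : before r' x y = before r y x.
  apply: eq_forallb => i; rewrite /r'.
  by have := le_max i x; have := le_max i y; lia.
exists r'; split=> //; split=> [i x y Sx Sy eq_xy|x y Sx Sy].
  apply: (r_inj i) => //; move: eq_xy; rewrite /r'.
  by have := le_max i x; have := le_max i y; lia.
by rewrite !bE orbC adjE.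
Qed.

(** Surplus indices repeat ranking 0, the default of [insubd], which leaves the common order
    unchanged. *)
Lemma realizer_pad S k n (r : 'I_k -> G -> nat) :
  0 < k -> k <= n -> realizer S r ->
  exists r' : 'I_n -> G -> nat,
    realizer S r' /\ forall x y, before r' x y = before r x y.
Proof.
move=> k_gt0 le_kn [r_inj adjE].
pose h (i : 'I_n) : 'I_k := insubd (Ordinal k_gt0) (i : nat).
have bE x y : before (fun i => r (h i)) x y = before r x y.
  apply/forallP/forallP=> lt_xy i; last exact: lt_xy.
  have := lt_xy (widen_ord le_kn i); suff -> : h (widen_ord le_kn i) = i by [].
  by apply: val_inj; rewrite val_insubd /= ltn_ord.
exists (fun i => r (h i)); split=> //; split=> [i|x y Sx Sy]; first exact: r_inj.
by rewrite !bE adjE.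
Qed.

(** Rank by [rQ] with the module [M] contracted to [m], then break ties inside [M] by [rM]. The
    formula for [before] lets [source_realizer] check that [m] remains a source. *)
Lemma realizer_subst S M m k (rM rQ : 'I_k -> G -> nat) :
  M \subset S -> m \in M ->
  (forall x y z, x \in M -> y \in M -> z \in S :\: M -> adj z x = adj z y) ->
  realizer M rM -> realizer (m |: (S :\: M)) rQ ->
  exists r : 'I_k -> G -> nat, realizer S r /\
    {in S &, forall x y, before r x y =
      if (x \in M) && (y \in M) then before rM x y
      else before rQ (if x \in M then m else x) (if y \in M then m else y)}.
Proof.
move=> sMS mM mod [injM adjM] [injQ adjQ].
pose pi x := if x \in M then m else x.
have piQ x : x \in S -> pi x \in m |: (S :\: M).
  by rewrite /pi !inE; case: ifP => xM; rewrite ?eqxx //= xM => ->; rewrite orbT.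
have pi_eq x y : pi x = pi y -> (x \in M) && (y \in M) || (x == y).
  rewrite /pi; case: ifP => xM; case: ifP => yM //= e.
  - by rewrite -e mM in yM.
  - by rewrite e mM in xM.
  - by rewrite e eqxx.
pose r i := lexn (fun x => rQ i (pi x)) (rM i).
have bE : {in S &, forall x y, before r x y =
      if (x \in M) && (y \in M) then before rM x y else before rQ (pi x) (pi y)}.
  move=> x y Sx Sy; case: ifPn => [/andP[xM yM]|nM]; apply: eq_forallb => i;
    rewrite ltn_lexn.
    by rewrite /pi xM yM ltnn eqxx.
  case: (eqVneq x y) => [->|neq_xy]; first by rewrite !ltnn andbF.
  case: eqP => [/(injQ i _ _ (piQ x Sx) (piQ y Sy)) /pi_eq|]; last by rewrite orbF.
  by rewrite (negbTE nM) (negbTE neq_xy).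
exists r; split=> //; split=> [i x y Sx Sy|x y Sx Sy].
  move=> /lexn_inj[/(injQ i _ _ (piQ x Sx) (piQ y Sy)) /pi_eq].
  by move=> /orP[/andP[xM yM]|/eqP //]; apply: injM.
rewrite !bE // [(y \in M) && _]andbC; case: ifPn => [/andP[xM yM]|nM].
  exact: adjM.
rewrite -adjQ ?piQ //; move: nM; rewrite /pi.
case: ifPn => xM; case: ifPn => yM //= _.
  by rewrite [LHS]adj_sym [RHS]adj_sym; apply: mod; rewrite // inE yM.
by apply: mod; rewrite // inE xM.
Qed.

Lemma connect_ind_r (T : finType) (e : rel T) (P : T -> Prop) x y :
  (forall u v, P u -> e u v -> P v) -> P x -> connect e x y -> P y.
Proof.
move=> step Px /connectP[p]; elim: p x Px => [|z p IH] x Px /=.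
  by move=> _ ->.
by move=> /andP[exz pz] yE; apply: IH pz yE; apply: step exz.
Qed.

(** * Implication classes and the triangle lemma *)

Section Forcing.
Variable S : {set G}.

Definition arc (p : G * G) : bool := [&& p.1 \in S, p.2 \in S & adj p.1 p.2].

(* Generates, on both orientations of the edges of [G[S]], the implication
   classes: in a transitive orientation, two edges [xy] and [xz] with [yz] not
   an edge both leave or both enter [x]. *)
Definition forced : rel (G * G) := fun p q =>
  [&& arc p, arc q & (q == (p.2, p.1)) || (p.1 == q.1) && ~~ adj p.2 q.2].

Lemma forced_sym : symmetric forced.
Proof.
move=> [a b] [c d]; rewrite /forced /=; case: (arc (a, b)); case: (arc (c, d)) => //=.
by rewrite !xpair_eqE [c == a]eq_sym [adj d b]adj_sym [b == c]eq_sym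
  [d == a]eq_sym [in LHS]andbC.
Qed.

Lemma forced_connect_sym p q : connect forced p q = connect forced q p.
Proof. exact: (sym_connect_sym forced_sym). Qed.

Lemma connect_arc p q : arc p -> connect forced p q -> arc q.
Proof.
by move=> ap; apply: (@connect_ind_r _ _ arc _ _ _ ap) => u v _ /and3P[].
Qed.

(** If one edge entered [x] and the other left it, transitivity would make [yz] an edge. *)
Lemma orientation_forced o x y z : transitive_on S o ->
  arc (x, y) -> arc (x, z) -> ~~ adj y z -> o x y = o x z.
Proof.
move=> [h1 h2 h3] /and3P[/= Sx Sy axy] /and3P[/= _ Sz axz] nyz.
move: nyz; rewrite h1 // negb_or => /andP[nyz nzy].
have := axy; have := axz; rewrite !h1 //.
case oxy: (o x y); case oxz: (o x z) => //= ox1 ox2.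
  by rewrite (h3 x) in nzy.
by rewrite (h3 x) in nyz.
Qed.

(** A forcing step preserves the values of both orientations or negates both. *)
Lemma agree_forced o o' p q : transitive_on S o -> transitive_on S o' ->
  arc p -> connect forced p q ->
  (o q.1 q.2 == o' q.1 q.2) = (o p.1 p.2 == o' p.1 p.2).
Proof.
move=> to to' ap; apply: (@connect_ind_r _ _
  (fun q => (o q.1 q.2 == o' q.1 q.2) = (o p.1 p.2 == o' p.1 p.2))) => //.
move=> [x y] [x' z] /= <- /and3P[axy axz /orP[/eqP[-> ->]|]] /=; last first.
  move=> /andP[/eqP /= e nyz]; subst x'.
  by rewrite -(orientation_forced to axy axz) // -(orientation_forced to' axy axz).
case/and3P: axy => /= Sx Sy a.
have rev (u : rel G) : transitive_on S u -> u y x = ~~ u x y.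
  case=> h1 h2 _; move: a (h2 x y Sx Sy); rewrite h1 //.
  by case: (u x y); case: (u y x).
by rewrite !rev //; case: (o x y); case: (o' x y).
Qed.

Variables (p : G * G).
Hypothesis arc_p : arc p.

Lemma connect_swap x y : connect forced p (x, y) -> connect forced p (y, x).
Proof.
move=> pxy; have /and3P[/= Sx Sy axy] := connect_arc arc_p pxy.
apply: (connect_trans pxy); apply: connect1.
by rewrite /forced /arc /= Sx Sy axy adj_sym axy eqxx.
Qed.

Lemma connect_step x y z : connect forced p (x, y) -> arc (x, z) ->
  ~~ adj y z -> connect forced p (x, z).
Proof.
move=> pxy axz nyz; apply: (connect_trans pxy); apply: connect1.
by rewrite /forced (connect_arc arc_p pxy) axz /= eqxx nyz orbT.
Qed.

(** A form of Gallai's triangle lemma: the invariant [P] survives each forcing step. *)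
Lemma triangle_class z b c b' c' : z \in S ->
  connect forced p (b, c) -> connect forced p (b', c') ->
  adj z b -> adj z c ->
  ~~ connect forced p (b, z) -> ~~ connect forced p (c, z) ->
  adj z b' /\ adj z c'.
Proof.
move=> Sz pbc pbc' zb zc nbz ncz.
pose P q := [/\ connect forced p q, adj z q.1, adj z q.2,
               ~~ connect forced p (q.1, z) & ~~ connect forced p (q.2, z)].
suff : P (b', c') by case.
have : connect forced (b, c) (b', c').
  by apply: connect_trans pbc'; rewrite forced_connect_sym.
apply: (@connect_ind_r _ _ P); last by [].
move=> {b c b' c' pbc pbc' zb zc nbz ncz} [x y] [x' y'].
move=> [/= pxy zx zy nxz nyz] f; have pq := connect_trans pxy (connect1 f).
move: f => /and3P[/and3P[/= Sx Sy axy] /and3P[/= Sx' Sy' axy']].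
case/orP=> [/eqP[ex ey]|/andP[/eqP /= ex nyy']]; subst x'; first by subst y'.
(* Otherwise [xy'] would force [xz] into the class. Below, likewise, [zy'] in the class would force
   [zy] into it. *)
have zy' : adj z y'.
  apply: contraR nxz => nzy'; apply: (connect_step pq).
    by rewrite /arc /= Sx Sz adj_sym.
  by rewrite adj_sym.
split=> //=; apply: contra nyz => /connect_swap py'; apply: connect_swap.
by apply: (connect_step py'); rewrite /arc /= ?Sz ?Sy // adj_sym.
Qed.

Definition class_span : {set G} := [set x | [exists y, connect forced p (x, y)]].

Lemma class_spanP x : reflect (exists y, connect forced p (x, y)) (x \in class_span).
Proof. by rewrite inE; apply: existsP. Qed.

Lemma class_span_sub : class_span \subset S.
Proof.
by apply/subsetP=> x /class_spanP[y /(connect_arc arc_p)/and3P[]].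
Qed.

(** No edge from [z] to the span lies in the class, so [z] sees both ends of a class edge or
    neither; the triangle lemma spreads this to the whole span. *)
Lemma class_span_module x y z : x \in class_span -> y \in class_span ->
  z \in S :\: class_span -> adj z x = adj z y.
Proof.
suff imp u v : u \in class_span -> v \in class_span ->
    z \in S :\: class_span -> adj z u -> adj z v.
  by move=> xM yM zM; apply/idP/idP; apply: imp.
move=> /class_spanP[c puc] /class_spanP[d pvd]; rewrite inE => /andP[zM Sz] zu.
have nz w : ~~ connect forced p (w, z).
  by apply: contra zM => /connect_swap pw; apply/class_spanP; exists w.
have zc : adj z c.
  apply: contraR (nz u) => nzc; apply: (connect_step puc); last by rewrite adj_sym.
  by have /and3P[/= Su _ _] := connect_arc arc_p puc; rewrite /arc /= Su Sz adj_sym.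
by have [] := triangle_class Sz puc pvd zu zc (nz _) (nz _).
Qed.

End Forcing.

(* A class of edges on which two orientations disagree and one on which they
   agree, both meeting [m], yield by the triangle lemma a nontrivial module
   containing [m]. *)
Lemma nontrivial_module S m a b o o' : transitive_on S o -> transitive_on S o' ->
  m \in S -> a \in S -> b \in S -> o a m -> o m b ->
  {in S, forall x, ~~ o' x m} ->
  exists M : {set G}, [/\ m \in M, M \proper S, exists2 c, c \in M & c != m
    & forall x y z, x \in M -> y \in M -> z \in S :\: M -> adj z x = adj z y].
Proof.
move=> to to' Sm Sa Sb oam omb src.
have [[h1 h2 h3] [h1' h2' _]] := (to, to').
have oab : o a b by apply: (h3 m).
have aam : adj a m by rewrite h1 // oam.
have amb : adj m b by rewrite h1 // omb.
have aab : adj a b by rewrite h1 // oab.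
have nma : o m a = false by apply: contraNF (h2 m a Sm Sa) => ->; rewrite oam.
have o'ma : o' m a.
  by move: (aam); rewrite h1' // (negbTE (src a Sa)).
have o'mb : o' m b.
  by move: (amb); rewrite h1' // (negbTE (src b Sb)) orbF.
(* The class of [mc] spans the module. It misses [z], since the triangle lemma would otherwise make
   [z] adjacent to itself. *)
have span c z : c \in S -> z \in S -> adj m c -> adj z m -> adj z c ->
    ~~ connect (forced S) (m, c) (m, z) -> ~~ connect (forced S) (m, c) (c, z) ->
    exists M : {set G}, [/\ m \in M, M \proper S, exists2 c, c \in M & c != m
    & forall x y z, x \in M -> y \in M -> z \in S :\: M -> adj z x = adj z y].
  move=> Sc Sz mc zm zc nmz ncz; exists (class_span S (m, c)).
  have ar : arc S (m, c) by rewrite /arc /= Sm Sc.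
  split.
  - by apply/class_spanP; exists c.
  - rewrite properE class_span_sub //=; apply/subsetPn; exists z => //.
    apply/negP=> /class_spanP[y pzy].
    have [] := triangle_class ar Sz (connect0 _ _) pzy zm zc nmz ncz.
    by rewrite adj_irr.
  - exists c; last by apply: contraTneq mc => ->; rewrite adj_irr.
    by apply/class_spanP; exists m; apply: (connect_swap ar).
  - exact: class_span_module.
have agr c q (Sc : c \in S) (mc : adj m c) (pq : connect (forced S) (m, c) q) :
    (o q.1 q.2 == o' q.1 q.2) = (o m c == o' m c).
  by apply: agree_forced to to' _ pq; rewrite /arc /= Sm Sc.
(* [o] and [o'] agree on [mb] and disagree on [ma]. If they agree on [ab], the class of [ma] avoids
   [mb] and [ab]; otherwise the class of [mb] avoids [ma] and [ab]. *)
case o'ab : (o' a b).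
  have ama : adj m a by rewrite adj_sym.
  apply: (span a b); rewrite // 1?[adj _ _]adj_sym //.
    by apply/negP=> /(agr _ _ Sa ama); rewrite /= omb o'mb nma o'ma.
  by apply/negP=> /(agr _ _ Sa ama); rewrite /= oab o'ab nma o'ma.
apply: (span b a); rewrite //.
  by apply/negP=> /(agr _ _ Sb amb); rewrite /= omb o'mb nma o'ma.
have ar : arc S (m, b) by rewrite /arc /= Sm Sb.
apply/negP=> /(connect_swap ar)/(agr b (a, b) Sb amb).
by rewrite /= oab o'ab omb o'mb.
Qed.

Lemma source_realizer S m k (r : 'I_k -> G -> nat) o : 0 < k -> m \in S ->
  realizer S r -> transitive_on S o -> {in S, forall x, ~~ o x m} ->
  exists r' : 'I_k -> G -> nat,
    realizer S r' /\ {in S, forall x, ~~ before r' x m}.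
Proof.
move=> k_gt0; have [n] := ubnP #|S|; elim: n => // n IH in S r *.
move=> leSn Sm rS toS src.
case: (boolP [exists x in S, before r x m]) => [|nsrc]; last first.
  exists r; split=> // x Sx; apply: contra nsrc => rxm.
  by apply/exists_inP; exists x.
case/exists_inP=> a Sa ram.
(* If no arc leaves [m], reversing all rankings turns this sink into a source. *)
case: (boolP [exists x in S, before r m x]) => [|nsnk]; last first.
  have [r' [rS' r'E]] := realizer_rev rS; exists r'; split=> // x Sx.
  by rewrite r'E; apply: contra nsnk => rxm; apply/exists_inP; exists x.
case/exists_inP=> b Sb rmb.
have to := before_transitive_on k_gt0 rS.
have [M [mM pMS [c cM ncm] mod]] := nontrivial_module to toS Sm Sa Sb ram rmb src.
have sMS := proper_sub pMS; have /subsetP sMS' := sMS.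
(* [Q] models the quotient, with [m] representing [M]; it omits [c], hence is smaller than [S]. *)
set Q := m |: (S :\: M).
have sQS : Q \subset S by rewrite subUset sub1set Sm subsetDl.
have /subsetP sQS' := sQS.
have pQS : Q \proper S.
  rewrite properE sQS; apply/subsetPn; exists c; first exact: sMS'.
  by rewrite !inE cM (negbTE ncm).
have [rM [rM_r rM_src]] : exists r' : 'I_k -> G -> nat,
    realizer M r' /\ {in M, forall x, ~~ before r' x m}.
  apply: (IH M r) => //.
  - by have := proper_card pMS; lia.
  - exact: realizer_sub rS.
  - exact: transitive_on_sub toS.
  - by move=> x /sMS'; apply: src.
have [rQ [rQ_r rQ_src]] : exists r' : 'I_k -> G -> nat,
    realizer Q r' /\ {in Q, forall x, ~~ before r' x m}.
  apply: (IH Q r) => //.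
  - by have := proper_card pQS; lia.
  - by rewrite setU11.
  - exact: realizer_sub rS.
  - exact: transitive_on_sub toS.
  - by move=> x /sQS'; apply: src.
have [r' [rS' r'E]] := realizer_subst sMS mM mod rM_r rQ_r.
exists r'; split=> // x Sx; rewrite r'E // mM andbT.
case: ifP => xM; first exact: rM_src.
by rewrite xM; apply: rQ_src; rewrite !inE xM Sx orbT.
Qed.

End Realizers.

(** * Transport along embeddings; sources and sinks *)

Section Pullback.
Variables (G H : sgraph) (S : {set G}) (S' : {set H}) (f : G -> H).
Hypotheses (fS : {in S, forall x, f x \in S'}) (f_inj : {in S &, injective f}).
Hypothesis (f_adj : {in S &, forall x y, adj (f x) (f y) = adj x y}).

Lemma realizer_pullback k (r : 'I_k -> H -> nat) :
  realizer S' r -> realizer S (fun i x => r i (f x)).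
Proof.
move=> [r_inj adjE]; split=> [i x y Sx Sy /r_inj e|x y Sx Sy].
  by apply: f_inj => //; apply: e; apply: fS.
by rewrite -f_adj // adjE ?fS.
Qed.

Lemma transitive_on_pullback (o : rel H) :
  transitive_on S' o -> transitive_on S (fun x y => o (f x) (f y)).
Proof.
move=> [h1 h2 h3]; split=> [x y Sx Sy|x y Sx Sy|y x z Sy Sx Sz].
- by rewrite -f_adj // h1 ?fS.
- by rewrite h2 ?fS.
- by apply: h3; apply: fS.
Qed.

End Pullback.

Lemma sourceP (T : finType) (o : rel T) x :
  source o x <-> (forall y, ~~ o y x).
Proof.
rewrite /source /in_degree; split=> [/eqP|src].
  by rewrite cards_eq0 => /eqP/setP o0 y; have := o0 y; rewrite !inE => ->.
by apply/eqP; rewrite cards_eq0; apply/eqP/setP=> y; rewrite !inE (negbTE (src y)).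
Qed.

Lemma sinkP (T : finType) (o : rel T) x :
  sink o x <-> (forall y, ~~ o x y).
Proof. exact: (sourceP (fun y z => o z y)). Qed.

(** * Alternation in concatenated permutations *)

Section Words.
Variable T : eqType.
Implicit Types (x y : T) (p : seq T) (bs : seq bool).

Lemma filter_pair p x y : uniq p -> x != y -> x \in p -> y \in p ->
  [seq c <- p | (c == x) || (c == y)] =
  if index x p < index y p then [:: x; y] else [:: y; x].
Proof.
move=> + neq_xy; elim: p => //= c p IH /andP[ncp up].
rewrite !inE; case: (eqVneq c x) => [cx|ncx] /=.
  subst c; rewrite [y == x]eq_sym (negbTE neq_xy) /= => _ yp.
  rewrite -(filter_pred1_uniq up yp); congr (_ :: _); apply: eq_in_filter.
  by move=> z zp; case: eqP => // zx; rewrite -zx zp in ncp.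
case: (eqVneq c y) => [cy|ncy] /=.
  subst c => xp _.
  rewrite -(filter_pred1_uniq up xp); congr (_ :: _); apply: eq_in_filter.
  by move=> z zp; case: (eqVneq z y) => [zy|]; [rewrite -zy zp in ncp|rewrite orbF].
by rewrite ltnS; apply: IH.
Qed.

Definition pair_word x y bs :=
  flatten [seq if b then [:: x; y] else [:: y; x] | b <- bs].

Lemma size_pair_word x y bs : size (pair_word x y bs) = (size bs).*2.
Proof.
by rewrite /pair_word; elim: bs => //= b bs IH; rewrite size_cat IH; case: b.
Qed.

Lemma alt_word2 x y n : alt_word x y n.+2 = [:: x, y & alt_word x y n].
Proof.
rewrite /alt_word /mkseq /= (iotaDl 2 0) -map_comp; congr [:: _, _ & _].
by apply: eq_map => i /=; rewrite negbK.
Qed.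

Lemma pair_word_alt x y bs : x != y ->
  (pair_word x y bs == alt_word x y (size bs).*2) = all id bs.
Proof.
move=> neq_xy; elim: bs => //= b bs IH; rewrite doubleS alt_word2.
case: b => /=; first by rewrite !eqseq_cons !eqxx -IH.
by rewrite eqseq_cons eq_sym (negbTE neq_xy).
Qed.

Lemma pair_wordC x y bs : pair_word x y bs = pair_word y x (map negb bs).
Proof.
by rewrite /pair_word -map_comp; congr flatten; apply: eq_map => -[].
Qed.

(** Each permutation contributes a block [xy] or [yx], and two unlike consecutive blocks repeat a
    letter. *)
Lemma alternate_flatten (ps : seq (seq T)) x y : x != y ->
  {in ps, forall p, [/\ uniq p, x \in p & y \in p]} ->
  alternate (flatten ps) x y =
  all (fun p => index x p < index y p) ps || all (fun p => index y p < index x p) ps.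
Proof.
move=> neq_xy ps_ok; pose bs := [seq index x p < index y p | p <- ps].
have -> : all (fun p => index x p < index y p) ps = all id bs.
  by rewrite all_map; apply: eq_all.
have -> : all (fun p => index y p < index x p) ps = all id (map negb bs).
  rewrite !all_map; apply: eq_in_all => p /ps_ok[_ xp yp] /=.
  rewrite -leqNgt [RHS]leq_eqVlt; case: eqP => // e.
  by case/eqP: neq_xy; rewrite -[y](nth_index x yp) e nth_index.
rewrite /alternate filter_flatten.
have -> : flatten [seq [seq c <- p | (c == x) || (c == y)] | p <- ps] =
    pair_word x y bs.
  rewrite /pair_word -map_comp; congr flatten; apply/eq_in_map => p /ps_ok[up xp yp].
  exact: filter_pair.
rewrite size_pair_word pair_word_alt // pair_wordC.
by rewrite -[size bs](size_map negb) pair_word_alt // eq_sym.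
Qed.

End Words.

(** * Permutation words versus realizers *)

Section PermRealizer.
Variable G : sgraph.

Lemma vertex_permP (p : seq G) :
  vertex_permutation p -> uniq p /\ forall x, x \in p.
Proof.
move=> pp; split; first by rewrite (perm_uniq pp) enum_uniq.
by move=> x; rewrite (perm_mem pp) mem_enum.
Qed.

(** Zero permutations give the empty word, which misses [x]. *)
Lemma perm_representable_gt0 (x : G) k : perm_representable G k -> 0 < k.
Proof. by move=> [[|p ps] [<- // _ [/(_ x)]]]. Qed.

Lemma perm_representable_realizer k :
  perm_representable G k -> exists r : 'I_k -> G -> nat, realizer [set: G] r.
Proof.
move=> ps_rep; have [ps [sz /allP ps_perm [_ rep]]] := ps_rep.
have psP p : p \in ps -> uniq p /\ forall x, x \in p.
  by move=> /ps_perm/vertex_permP.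
pose r (i : 'I_k) x := index x (nth [::] ps i).
have bE x y : before r x y = all (fun p => index x p < index y p) ps.
  apply/forallP/(all_nthP [::]) => [h i lt_i|h i].
    by rewrite sz in lt_i; apply: (h (Ordinal lt_i)).
  by apply: h; rewrite sz.
exists r; split=> [i x y _ _|x y _ _].
  have [_ pi] : uniq (nth [::] ps i) /\ forall x, x \in nth [::] ps i.
    by apply: psP; rewrite mem_nth ?sz.
  by rewrite /r => e; rewrite -[y](nth_index x (pi y)) -e nth_index.
case: (eqVneq x y) => [<-|neq_xy].
  have k_gt0 := perm_representable_gt0 x ps_rep; rewrite adj_irr orbb; apply/esym/negbTE/negP.
  by move=> /forallP/(_ (Ordinal k_gt0)); rewrite ltnn.
rewrite rep // alternate_flatten // ?bE // => p /psP[up pT].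
by split.
Qed.

Lemma realizer_perm_representable k (r : 'I_k -> G -> nat) :
  0 < k -> realizer [set: G] r -> perm_representable G k.
Proof.
move=> k_gt0 [r_inj adjE].
pose s i := sort (relpre (r i) leq) (enum G).
have sP i : uniq (s i) /\ forall x, x \in s i.
  by apply: vertex_permP; rewrite /vertex_permutation /s perm_sort.
have sE i x y : (index x (s i) < index y (s i)) = (r i x < r i y).
  have tot : total (relpre (r i) leq) by move=> u v; apply: leq_total.
  have tr : transitive (relpre (r i) leq) by move=> u v w; apply: leq_trans.
  have [ui mi] := sP i.
  have imp u v : index u (s i) < index v (s i) -> r i u < r i v.
    move=> lt_uv; rewrite ltn_neqAle; apply/andP; split.
      by apply: contraTneq lt_uv => /r_inj -> //; rewrite ltnn.
    have := sorted_ltn_index tr (sort_sorted tot (enum G)).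
    by apply=> //; rewrite -?/(s i) ?mi.
  apply/idP/idP; first exact: imp.
  apply: contraTT; rewrite -!leqNgt [in X in X -> _]leq_eqVlt => /orP[/eqP e|/imp /ltnW //].
  suff -> : x = y by [].
  by rewrite -[y](nth_index x (mi y)) e nth_index.
exists [seq s i | i <- enum 'I_k]; split.
- by rewrite size_map size_enum_ord.
- by apply/allP=> p /mapP[i _ ->]; rewrite /vertex_permutation perm_sort.
split=> [x|x y neq_xy].
  apply/flatten_mapP; exists (Ordinal k_gt0); first by rewrite mem_enum.
  exact: (sP _).2.
rewrite adjE ?inE // alternate_flatten //; last first.
  by move=> p /mapP[i _ ->]; have [ui mi] := sP i.
have bE u v : before r u v =
    all (fun p => index u p < index v p) [seq s i | i <- enum 'I_k].
  rewrite all_map; apply/forallP/allP => [h i _|h i] /=; first by rewrite sE.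
  by rewrite -sE; apply: h; rewrite mem_enum.
by rewrite !bE.
Qed.

End PermRealizer.

(** * Neighborhoods in connected graphs *)

Lemma connected_neighbor (G : sgraph) (m v : G) :
  connected G -> v != m -> exists a, adj m a.
Proof.
move=> /(_ m v)/connectP[[|a p] /= mp vE]; first by rewrite vE eqxx.
by exists a; case/andP: mp.
Qed.

(** Otherwise the closed neighborhood of [m] would be stable under adjacency and so contain [v]. *)
Lemma connected_boundary (G : sgraph) (m v : G) :
  connected G -> v != m -> ~~ adj m v ->
  exists a x, [/\ adj m a, adj a x, ~~ adj m x & x != m].
Proof.
move=> conn neq_vm nmv; apply: NNPP => no.
suff : (v == m) || adj m v by rewrite (negbTE neq_vm) (negbTE nmv).
apply: (@connect_ind_r _ _ (fun u => (u == m) || adj m u)) (conn m v) => [a x|];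
  last by rewrite eqxx.
case/orP=> [/eqP -> ->|ma ax]; first by rewrite orbT.
apply/negPn/negP; rewrite negb_or => /andP[nxm nmx].
by apply: no; exists a, x.
Qed.

(** * Copies of the two graphs inside the recomposition *)

Section Embedding.
Variables (G G' : sgraph) (m : G) (m' : G').
Local Notation H := (split_recomp m m').

Definition recomp_swap (u : split_recomp m' m) : H :=
  match u with inl x => inr x | inr x => inl x end.

Lemma recomp_swap_inj : injective recomp_swap.
Proof. by move=> [x|x] [y|y] //= [->]. Qed.

Lemma recomp_swap_adj u v : adj (recomp_swap u) (recomp_swap v) = adj u v.
Proof. by case: u v => [x|x] [y|y] //=; rewrite andbC. Qed.

(** When [a'] is a neighbor of [m'], its neighbors in [V] are exactly those of [m], so it can stand
    for the marker. *)
Definition embed_left (a' : {x : G' | x != m'}) (x : G) : H :=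
  if insub x is Some u then inl u else inr a'.

Variable a' : {x : G' | x != m'}.

Lemma embed_left_marker : embed_left a' m = inr a'.
Proof. by rewrite /embed_left insubF ?eqxx. Qed.

Lemma embed_leftE (x : {x : G | x != m}) : embed_left a' (val x) = inl x.
Proof. by rewrite /embed_left valK. Qed.

Variant embed_left_spec : G -> H -> Type :=
| EmbedMarker : embed_left_spec m (inr a')
| EmbedVertex (x : {x : G | x != m}) : embed_left_spec (val x) (inl x).

Lemma embed_leftP x : embed_left_spec x (embed_left a' x).
Proof.
case: (eqVneq x m) => [->|xm]; first by rewrite embed_left_marker; constructor.
by rewrite -[x]/(val (exist (fun x => x != m) x xm)) embed_leftE; constructor.
Qed.

Lemma embed_left_inj : injective (embed_left a').
Proof. by move=> x y; case: embed_leftP => [|u]; case: embed_leftP => // v [->]. Qed.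

Lemma embed_left_adj : adj m' (val a') ->
  forall x y, adj (embed_left a' x) (embed_left a' y) = adj x y.
Proof.
move=> ma' x y; case: embed_leftP => [|u]; case: embed_leftP => [|v] //=.
- by rewrite !adj_irr.
- by rewrite ma' andbT.
- by rewrite ma' andbT adj_sym.
Qed.

End Embedding.

(** * Realizers and forcing in the recomposition *)

Section Recomposition.
Variables (G G' : sgraph) (m : G) (m' : G').
Local Notation H := (split_recomp m m').

Definition recomp_representable k :=
  exists r : 'I_k -> H -> nat, realizer [set: H] r.

(** Gives the lower bound; the second vertex of [G'] ensures that [m'] has a neighbor to stand for
    [m]. *)
Lemma realizer_embed_left k : connected G' -> (exists v : G', v != m') ->
  recomp_representable k -> exists r : 'I_k -> G -> nat, realizer [set: G] r.
Proof.
move=> conn [v vm] [r rH]; have [a ma] := connected_neighbor conn vm.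
have am : a != m' by apply: contraTneq ma => ->; rewrite adj_irr.
pose f := embed_left m (exist (fun x => x != m') a am).
exists (fun i x => r i (f x)); apply: realizer_pullback rH => // [x y _ _|x y _ _].
  exact: embed_left_inj.
exact: embed_left_adj.
Qed.

Lemma recomp_universal k (r : 'I_k -> G -> nat) (r' : 'I_k -> G' -> nat) :
  0 < k -> realizer [set: G] r -> realizer [set: G'] r' ->
  (forall v, v != m -> adj m v) -> recomp_representable k.
Proof.
move=> k_gt0 rG rG' univ.
pose f (u : H) : G := if u is inl x then val x else m.
pose f' (u : H) : G' := if u is inr x then val x else m'.
(* With [V] empty, the recomposition is [G'] without its marker. *)
case: (pickP (fun x : G => x != m)) => [v vm|none]; last first.
  have bad (x : {x : G | x != m}) : False by have := none (val x); rewrite (valP x).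
  exists (fun i u => r' i (f' u)); apply: realizer_pullback rG' => //.
  - by move=> [/bad //|x] [/bad //|y] _ _ /val_inj ->.
  - by move=> [/bad //|x] [/bad //|y].
(* [u0] represents the module [V] and plays the role of [m']: since [m] is universal, both have the
   same neighbors in [V']. *)
pose u0 : H := inl (exist (fun x => x != m) v vm).
pose M : {set H} := [set u | if u is inl _ then true else false].
have fM : realizer M (fun i u => r i (f u)).
  apply: realizer_pullback rG => //.
  - by move=> [x|x] [y|y]; rewrite !inE //= => _ _ /val_inj ->.
  - by move=> [x|x] [y|y]; rewrite !inE.
have fQ : realizer (u0 |: ([set: H] :\: M)) (fun i u => r' i (f' u)).
  apply: realizer_pullback rG' => //.
  - move=> [x|x] [y|y]; rewrite !inE /= ?orbF.
    + by move=> /eqP -> /eqP ->.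
    + by move=> _ _ e; have /eqP[] := valP y; exact: esym e.
    + by move=> _ _ e; have /eqP[] := valP x; exact: e.
    + by move=> _ _ /val_inj ->.
  - move=> [x|x] [y|y]; rewrite !inE /= ?orbF.
    + by move=> /eqP[->] /eqP[->]; rewrite !adj_irr.
    + by move=> _ _; rewrite univ // (valP x).
    + by move=> _ _; rewrite univ ?(valP y) // adj_sym.
    + by [].
have [|||rH [rHP _]] := realizer_subst _ _ _ fM fQ.
- exact: subsetT.
- by rewrite inE.
- by move=> [x|x] [y|y] [z|z]; rewrite !inE //= !univ ?(valP x) ?(valP y).
- by exists rH.
Qed.

(* Within [Q i] the elements below the markers precede those above them, [V]
   coming first on either side; hence [inr x'] precedes [inl x] everywhere
   exactly when [x'] is below [m'] and [x] is above [m]. The extra permutation,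
   [V'] before [V], keeps [inl x] from preceding any [inr x']. *)
Lemma recomp_source_sink k (r : 'I_k -> G -> nat) (r' : 'I_k -> G' -> nat) :
  0 < k -> realizer [set: G] r -> realizer [set: G'] r' ->
  (forall x, ~~ before r x m) -> (forall x, ~~ before r' m' x) ->
  recomp_representable k.+1.
Proof.
move=> k_gt0 [r_inj adjE] [r'_inj adjE'] src snk.
pose i0 := Ordinal k_gt0.
pose rank i (u : H) := match u with inl x => r i (val x) | inr x => r' i (val x) end.
pose block i (u : H) := match u with
  | inl x => if r i (val x) < r i m then 0 else 2
  | inr x => if r' i (val x) < r' i m' then 1 else 3 end.
pose side (u : H) := if u is inl _ then 1 else 0.
(* [ord0] indexes the extra permutation. Sorting by [rank i0] there adds no constraint within a
   side, as [i0] also occurs among the lifted indices. *)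
pose Q (i : 'I_k.+1) : H -> nat :=
  if unlift ord0 i is Some j then lexn (block j) (rank j) else lexn side (rank i0).
have QE u v : before Q u v = (lexn side (rank i0) u < lexn side (rank i0) v) &&
    [forall j, lexn (block j) (rank j) u < lexn (block j) (rank j) v].
  apply/forallP/andP=> [h|[h0 /forallP h] i].
    split; first by have := h ord0; rewrite /Q unlift_none.
    by apply/forallP=> j; have := h (lift ord0 j); rewrite /Q liftK.
  by rewrite /Q; case: unliftP.
have val_m i (x : {x : G | x != m}) : r i (val x) <> r i m.
  by move=> /r_inj e; have := valP x; rewrite e ?inE // eqxx.
have val_m' i (x : {x : G' | x != m'}) : r' i (val x) <> r' i m'.
  by move=> /r'_inj e; have := valP x; rewrite e ?inE // eqxx.
exists Q; split.
  move=> i [x|x] [y|y] _ _; rewrite /Q; case: unliftP => [j|] _ /lexn_inj[] //=.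
  - by move=> _ /r_inj e; congr inl; apply: val_inj; apply: e.
  - by move=> _ /r_inj e; congr inl; apply: val_inj; apply: e.
  - by case: ifP; case: ifP.
  - by case: ifP; case: ifP.
  - by move=> _ /r'_inj e; congr inr; apply: val_inj; apply: e.
  - by move=> _ /r'_inj e; congr inr; apply: val_inj; apply: e.
have bLL (x y : {x : G | x != m}) :
    before Q (inl x) (inl y) = before r (val x) (val y).
  rewrite QE ltn_lexn /=; apply/andP/forallP=> [[_ /forallP h] i|h].
    have := h i; rewrite ltn_lexn /=.
    by have := val_m i x; have := val_m i y; case: ifP; case: ifP; lia.
  split; first exact: h.
  apply/forallP=> i; have := h i; rewrite ltn_lexn /=.
  by have := val_m i x; have := val_m i y; case: ifP; case: ifP; lia.
have bRR (x y : {x : G' | x != m'}) :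
    before Q (inr x) (inr y) = before r' (val x) (val y).
  rewrite QE ltn_lexn /=; apply/andP/forallP=> [[_ /forallP h] i|h].
    have := h i; rewrite ltn_lexn /=.
    by have := val_m' i x; have := val_m' i y; case: ifP; case: ifP; lia.
  split; first exact: h.
  apply/forallP=> i; have := h i; rewrite ltn_lexn /=.
  by have := val_m' i x; have := val_m' i y; case: ifP; case: ifP; lia.
have bLR (x : {x : G | x != m}) (y : {x : G' | x != m'}) :
    before Q (inl x) (inr y) = false.
  by rewrite QE ltn_lexn.
have bRL (x : {x : G | x != m}) (y : {x : G' | x != m'}) :
    before Q (inr y) (inl x) = adj m (val x) && adj m' (val y).
  (* As [m] is a source and [m'] a sink, the two adjacencies put [x] above [m] and [y] below [m'] in
     every ranking: blocks 2 and 1. *)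
  rewrite adjE ?inE // (negbTE (src _)) orbF adjE' ?inE // (negbTE (snk _)) /=.
  rewrite QE ltn_lexn /=; apply/forallP/andP=> [h|[/forallP h /forallP h'] i].
    split; apply/forallP=> i; have := h i; rewrite ltn_lexn /=;
      by move: (val_m i x) (val_m' i y) => /=; case: ifP; case: ifP; lia.
  by have := h i; rewrite ltn_lexn /= h'; case: ifP; lia.
move=> [x|x] [y|y] _ _; rewrite ?bLL ?bRR ?bLR ?bRL ?orbF //=.
- exact: adjE.
- exact: adjE'.
Qed.

(* The edge [ax] fixes the direction of all edges from [a] to [N_{G'}(m')];
   hence [m'] is a source or a sink once replaced by [a]. *)
Lemma recomp_forced (T : rel H) (a x : {x : G | x != m}) (b b' : {x : G' | x != m'}) :
  transitive_orientation T -> adj m (val a) -> adj (val a) (val x) ->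
  ~~ adj m (val x) -> adj m' (val b) -> adj m' (val b') ->
  T (inl a) (inr b) = T (inl a) (inr b').
Proof.
move=> /transitive_onT to ma ax nmx mb mb'.
have arcR c : adj m' (val c) -> arc [set: H] (inl a, inr c).
  by move=> mc; rewrite /arc !inE /= ma mc.
have arcL : arc [set: H] (inl a, inl x) by rewrite /arc !inE.
rewrite (orientation_forced to (arcR _ mb) arcL) /= ?(negbTE nmx) //.
by rewrite (orientation_forced to arcL (arcR _ mb')) /= ?(negbTE nmx).
Qed.

End Recomposition.

(** * From marker orientations to realizers and back *)

Lemma recomp_representable_swap (G G' : sgraph) (m : G) (m' : G') k :
  recomp_representable m' m k -> recomp_representable m m' k.
Proof.
move=> [r rH]; exists (fun i u => r i (recomp_swap u)).
apply: realizer_pullback rH => // [x y _ _|x y _ _].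
  exact: recomp_swap_inj.
exact: recomp_swap_adj.
Qed.

Lemma recomp_of_source_sink (G G' : sgraph) (m : G) (m' : G') k o o'
    (r : 'I_k -> G -> nat) (r' : 'I_k -> G' -> nat) :
  0 < k -> realizer [set: G] r -> realizer [set: G'] r' ->
  transitive_orientation o -> transitive_orientation o' ->
  source o m -> sink o' m' -> recomp_representable m m' k.+1.
Proof.
move=> k_gt0 rG rG' /transitive_onT to /transitive_onT to' /sourceP src /sinkP snk.
have [r1 [r1G r1_src]] := source_realizer k_gt0 (in_setT m) rG to (in1W src).
(* To make [m'] a sink, make it a source for the reversed orientation, then reverse the rankings. *)
have [r2 [r2G' r2_src]] :=
  source_realizer k_gt0 (in_setT m') rG' (transitive_on_rev to') (in1W snk).
have [r3 [r3G' r3E]] := realizer_rev r2G'.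
apply: recomp_source_sink r1G r3G' _ _ => // x; first exact: r1_src.
by rewrite r3E; apply: r2_src.
Qed.

(** Restrict [T] to copies of [G] and [G'], with [a'] standing for [m] and [a] for [m']. The edges
    [ax] and [a'x'] make the cross edges at [a] and at [a'] all point like the shared edge [aa']. *)
Lemma recomp_marker_orientations (G G' : sgraph) (m : G) (m' : G') :
  connected G -> connected G' -> comparability (split_recomp m m') ->
  (exists (o : rel G) (o' : rel G'),
     [/\ transitive_orientation o, transitive_orientation o'
       & (source o m /\ sink o' m') \/ (sink o m /\ source o' m')])
  \/ ((forall v : G, v != m -> adj m v) \/
      (forall v' : G', v' != m' -> adj m' v')).
Proof.
move=> connG connG' [T to].
case: (classic (forall v : G, v != m -> adj m v)) => [|nG]; first by right; left.
case: (classic (forall v : G', v != m' -> adj m' v)) => [|nG']; first by right; right.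
left.
have [a [x [ma ax nmx xm]]] : exists a x, [/\ adj m a, adj a x, ~~ adj m x & x != m].
  apply: NNPP => no; apply: nG => v vm; apply/negPn/negP=> nmv.
  by apply: no; apply: connected_boundary connG vm nmv.
have [a' [x' [ma' ax' nmx' xm']]] :
    exists a x, [/\ adj m' a, adj a x, ~~ adj m' x & x != m'].
  apply: NNPP => no; apply: nG' => v vm; apply/negPn/negP=> nmv.
  by apply: no; apply: connected_boundary connG' vm nmv.
have am : a != m by apply: contraTneq ma => ->; rewrite adj_irr.
have am' : a' != m' by apply: contraTneq ma' => ->; rewrite adj_irr.
pose sa : {x : G | x != m} := exist (fun x => x != m) a am.
pose sx : {x : G | x != m} := exist (fun x => x != m) x xm.
pose sa' : {x : G' | x != m'} := exist (fun x => x != m') a' am'.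
pose sx' : {x : G' | x != m'} := exist (fun x => x != m') x' xm'.
pose f := embed_left m sa'; pose f' u := recomp_swap (embed_left m' sa u).
have to1 : transitive_orientation (fun u v => T (f u) (f v)).
  apply/transitive_onT; move/transitive_onT: to.
  by apply: transitive_on_pullback => // u v _ _; apply: embed_left_adj.
have to2 : transitive_orientation (fun u v => T (f' u) (f' v)).
  apply/transitive_onT; move/transitive_onT: to.
  apply: transitive_on_pullback => // u v _ _.
  by rewrite recomp_swap_adj embed_left_adj.
(* Reversing [T] handles the opposite arcs; swapping the sides handles those at [a']. *)
have tr : transitive_orientation (fun u v => T v u).
  by apply/transitive_onT; apply: transitive_on_rev; apply/transitive_onT.
have ts (u : rel (split_recomp m m')) : transitive_orientation u ->
    transitive_orientation (fun x y : split_recomp m' m =>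
      u (recomp_swap x) (recomp_swap y)).
  move=> /transitive_onT tu; apply/transitive_onT; move: tu.
  by apply: transitive_on_pullback => // v w _ _; apply: recomp_swap_adj.
have out_a (b : {x : G' | x != m'}) : adj m' (val b) ->
    T (inl sa) (inr b) = T (inl sa) (inr sa').
  by move=> mb; apply: (recomp_forced to (x := sx)).
have in_a (b : {x : G' | x != m'}) : adj m' (val b) ->
    T (inr b) (inl sa) = T (inr sa') (inl sa).
  by move=> mb; apply: (recomp_forced tr (x := sx)).
have out_a' (b : {x : G | x != m}) : adj m (val b) ->
    T (inr sa') (inl b) = T (inr sa') (inl sa).
  by move=> mb; apply: (recomp_forced (ts _ to) (x := sx')).
have in_a' (b : {x : G | x != m}) : adj m (val b) ->
    T (inl b) (inr sa') = T (inl sa) (inr sa').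
  by move=> mb; apply: (recomp_forced (ts _ tr) (x := sx')).
have [[adjT asymT] _] := to.
have edge u v : T u v -> adj u v by rewrite adjT => ->.
have loop u : T u u = false by apply/negP=> /edge; rewrite adj_irr.
exists (fun u v => T (f u) (f v)), (fun u v => T (f' u) (f' v)); split=> //.
(* If [a] points to [a'], then [m] is a sink and [m'] a source; otherwise the roles are
   exchanged. *)
have := adjT (inl sa) (inr sa'); have := asymT (inl sa) (inr sa').
rewrite /= ma ma' /=; case Taa' : (T (inl sa) (inr sa')) => /= Ta'a.
  move=> _; right; split.
    apply/sinkP=> y; rewrite /f embed_left_marker.
    case: embed_leftP => [|u]; first by rewrite loop.
    apply/negP=> Tu; have /andP[mu _] := edge _ _ Tu.
    by rewrite out_a' // (negbTE Ta'a) in Tu.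
  apply/sourceP=> y; rewrite /f' embed_left_marker.
  case: embed_leftP => [|u] /=; first by rewrite loop.
  apply/negP=> Tu; have /andP[_ mu] := edge _ _ Tu.
  by rewrite in_a // (negbTE Ta'a) in Tu.
move=> _; left; split.
  apply/sourceP=> y; rewrite /f embed_left_marker.
  case: embed_leftP => [|u]; first by rewrite loop.
  apply/negP=> Tu; have /andP[mu _] := edge _ _ Tu.
  by rewrite in_a' // Taa' in Tu.
apply/sinkP=> y; rewrite /f' embed_left_marker.
case: embed_leftP => [|u] /=; first by rewrite loop.
apply/negP=> Tu; have /andP[_ mu] := edge _ _ Tu.
by rewrite out_a // Taa' in Tu.
Qed.

Theorem theorem10 (G G' : sgraph) (m : G) (m' : G') (k k' : nat)
    (connG : connected G) (connG' : connected G')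
    (compG : comparability G) (compG' : comparability G')
    (RpG : is_Rp G k) (RpG' : is_Rp G' k') :
  (comparability (split_recomp m m') <->
     (exists (o : rel G) (o' : rel G'),
        [/\ transitive_orientation o, transitive_orientation o'
          & (source o m /\ sink o' m') \/ (sink o m /\ source o' m')])
     \/ ((forall v : G, v != m -> adj m v) \/
         (forall v' : G', v' != m' -> adj m' v')))
  /\
  ((exists v : G, v != m) -> (exists v' : G', v' != m') ->
   comparability (split_recomp m m') ->
     is_Rp (split_recomp m m') (maxn k k') \/
     is_Rp (split_recomp m m') (1 + maxn k k')).
Proof.
have [[permG minG] [permG' minG']] := (RpG, RpG').
have k_gt0 := perm_representable_gt0 m permG.
have k'_gt0 := perm_representable_gt0 m' permG'.
set K := maxn k k'; have K_gt0 : 0 < K by rewrite leq_max k_gt0.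
have [_ /(realizer_pad k_gt0 (leq_maxl k k'))[r [rG _]]] :=
  perm_representable_realizer permG.
have [_ /(realizer_pad k'_gt0 (leq_maxr k k'))[r' [rG' _]]] :=
  perm_representable_realizer permG'.
have necessary := @recomp_marker_orientations G G' m m' connG connG'.
have upper :
     (exists (o : rel G) (o' : rel G'),
        [/\ transitive_orientation o, transitive_orientation o'
          & (source o m /\ sink o' m') \/ (sink o m /\ source o' m')])
     \/ ((forall v : G, v != m -> adj m v) \/
         (forall v' : G', v' != m' -> adj m' v')) ->
     recomp_representable m m' K.+1.
  have pad : recomp_representable m m' K -> recomp_representable m m' K.+1.
    by move=> [q /(realizer_pad K_gt0 (leqnSn K))[q' [? _]]]; exists q'.
  move=> [[o [o' [to to' [[src snk]|[snk src]]]]]|[univ|univ]].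
  - exact: recomp_of_source_sink rG rG' to to' src snk.
  - apply: recomp_representable_swap.
    exact: recomp_of_source_sink rG' rG to' to src snk.
  - by apply: pad; apply: recomp_universal rG rG' univ.
  - apply/pad/recomp_representable_swap.
    exact: recomp_universal rG' rG univ.
split.
  (* A realizer orients the recomposition transitively, so [upper] also gives sufficiency in (1). *)
  split=> // /upper[q qH]; exists (before q).
  by apply/transitive_onT; apply: before_transitive_on qH.
move=> nG nG' /necessary/upper[q qH].
have permH : perm_representable (split_recomp m m') K.+1.
  exact: realizer_perm_representable qH.
have lower j : perm_representable (split_recomp m m') j -> K <= j.
  move=> permj; case: (nG) => v vm.
  have j_gt0 := perm_representable_gt0
    (inl (exist (fun x => x != m) v vm) : split_recomp m m') permj.
  have [p pH] := perm_representable_realizer permj.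
  rewrite geq_max; apply/andP; split.
    have [|s sG] := @realizer_embed_left G G' m m' j connG' nG'; first by exists p.
    by apply: minG; apply: realizer_perm_representable sG.
  have [|s sG'] := @realizer_embed_left G' G m' m j connG nG.
    by apply: recomp_representable_swap; exists p.
  by apply: minG'; apply: realizer_perm_representable sG'.
(* The least number lies between [K] and [K.+1], so it is [K] exactly when [K] permutations
   suffice. *)
case: (classic (perm_representable (split_recomp m m') K)) => [permK|npermK].
  by left; split.
right; split=> // j permj; rewrite add1n ltn_neqAle lower // andbT.
by apply: contra_notN npermK => /eqP ->.
Qed.
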